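(* Let $X$ be a compact Hausdorff space. No nonempty open $F_\sigma$-subset of $X$ is an F-space if and only if every $\mathbb{R}$-linear local multiplication on $C(X)$ is a multiplication.
   Context: $C(X)$ denotes the algebra of complex-valued continuous functions on $X$, and $C_R(X)$ the real-valued ones. A map $T$ on $C(X)$ is a multiplication if there is $a\in C(X)$ with $T(f)=af$ for all $f\in C(X)$; it is a local multiplication if for each $f\in C(X)$ there is $a_f\in C(X)$ with $T(f)=a_f f$. An $F_\sigma$ set is a countable union of closed sets. For a completely regular Hausdorff space $S$, a cozero-set in $S$ is a set of the form $\{s\in S: f(s)\neq 0\}$ with $f\in C(S)$. A completely regular Hausdorff space $S$ is an F-space if for every cozero-set $A$ in $S$, every bounded function in $C_R(A)$ extends to a bounded function in $C_R(S)$. Subsets of $X$ carry the subspace topology. *)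

(* Defs.v *)
From HB Require Import structures.
From mathcomp Require Import all_boot all_order all_algebra.
From mathcomp Require Import complex.
From mathcomp Require Import all_classical all_reals all_analysis.
From mathcomp Require Import borel_hierarchy.

Set Implicit Arguments.
Unset Strict Implicit.
Unset Printing Implicit Defensive.

Import Order.TTheory GRing.Theory Num.Theory.
Import numFieldNormedType.Exports.

Local Open Scope classical_set_scope.
Local Open Scope complex_scope.
Local Open Scope ring_scope.

(* The library puts the norm topology on [R[i]^o] only; copy it to [R[i]]. *)
HB.instance Definition _ (R : rcfType) :=
  PseudoPointedMetric.copy R[i] R[i]^o.
HB.instance Definition _ (R : rcfType) := NormedModule.copy R[i] R[i]^o.

Definition cfun (R : realType) (X : topologicalType) : Type :=
  continuousType X R[i].

Section CfunAlgebra.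
Context {R : realType} {X : topologicalType}.
Implicit Types (f g h : cfun R X) (k : R).

HB.instance Definition _ := Choice.copy (cfun R X) (continuousType X R[i]).

Definition cfun_fun f : X -> R[i] := (f : continuousType X R[i]).
Coercion cfun_fun : cfun >-> Funclass.

Lemma cfunP f g : f =1 g -> f = g.
Proof. by move=> fg; apply/continuousEP. Qed.

Lemma cfun_cts f : continuous (f : X -> R[i]).
Proof. exact: (@cts_fun _ _ (f : continuousType X R[i])). Qed.

Definition mk_cfun (f : X -> R[i]) (cf : continuous f) : cfun R X :=
  (mkcts cf : continuousType X R[i]).

Fact cfun_cst_subproof (z : R[i]) : continuous (fun _ : X => z).
Proof. by move=> x; exact: cst_continuous. Qed.

Fact cfun_opp_subproof f : continuous (fun x => - f x).
Proof. by move=> x; exact: continuousN (@cfun_cts f x). Qed.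

Fact cfun_add_subproof f g : continuous (fun x => f x + g x).
Proof. by move=> x; exact: continuousD (@cfun_cts f x) (@cfun_cts g x). Qed.

Fact cfun_mul_subproof f g : continuous (fun x => f x * g x).
Proof. by move=> x; exact: continuousM (@cfun_cts f x) (@cfun_cts g x). Qed.

Fact cfun_scale_subproof k f : continuous (fun x => k%:C * f x).
Proof.
by move=> x; exact: continuousM (@cst_continuous _ _ _ x) (@cfun_cts f x).
Qed.

Definition cfun_cst z := mk_cfun (@cfun_cst_subproof z).
Definition cfun_opp f := mk_cfun (@cfun_opp_subproof f).
Definition cfun_add f g := mk_cfun (@cfun_add_subproof f g).
Definition cfun_mul f g := mk_cfun (@cfun_mul_subproof f g).
Definition cfun_scale k f := mk_cfun (@cfun_scale_subproof k f).

Fact cfun_addA : associative cfun_add.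
Proof. by move=> f g h; apply: cfunP => x; exact: addrA. Qed.
Fact cfun_addC : commutative cfun_add.
Proof. by move=> f g; apply: cfunP => x; exact: addrC. Qed.
Fact cfun_add0 : left_id (cfun_cst 0) cfun_add.
Proof. by move=> f; apply: cfunP => x; exact: add0r. Qed.
Fact cfun_addN : left_inverse (cfun_cst 0) cfun_opp cfun_add.
Proof. by move=> f; apply: cfunP => x; exact: addNr. Qed.

HB.instance Definition _ := GRing.isZmodule.Build (cfun R X)
  cfun_addA cfun_addC cfun_add0 cfun_addN.

Fact cfun_mulA : associative cfun_mul.
Proof. by move=> f g h; apply: cfunP => x; exact: mulrA. Qed.
Fact cfun_mulC : commutative cfun_mul.
Proof. by move=> f g; apply: cfunP => x; exact: mulrC. Qed.
Fact cfun_mul1 : left_id (cfun_cst 1) cfun_mul.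
Proof. by move=> f; apply: cfunP => x; exact: mul1r. Qed.
Fact cfun_mulDl : left_distributive cfun_mul cfun_add.
Proof. by move=> f g h; apply: cfunP => x; exact: mulrDl. Qed.

(* [comPzRingType], not [comNzRingType]: [X] may be empty. *)
HB.instance Definition _ := GRing.Zmodule_isComPzRing.Build (cfun R X)
  cfun_mulA cfun_mulC cfun_mul1 cfun_mulDl.

Lemma cfun_scaleE k f x : cfun_scale k f x = k%:C * f x.
Proof. by []. Qed.

Fact cfun_scaleA a b f : cfun_scale a (cfun_scale b f) = cfun_scale (a * b) f.
Proof. by apply: cfunP => x; rewrite !cfun_scaleE rmorphM mulrA. Qed.
Fact cfun_scale1 : left_id 1 cfun_scale.
Proof. by move=> f; apply: cfunP => x; rewrite cfun_scaleE rmorph1 mul1r. Qed.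
Fact cfun_scaleDr : right_distributive cfun_scale +%R.
Proof. by move=> k f g; apply: cfunP => x; exact: mulrDr. Qed.
Fact cfun_scaleDl f : {morph cfun_scale^~ f : a b / a + b}.
Proof. by move=> a b; apply: cfunP => x; rewrite cfun_scaleE rmorphD mulrDl. Qed.

(* Only real scalars act, so that [{linear cfun R X -> cfun R X}] is the
   type of R-linear maps. *)
HB.instance Definition _ := GRing.Zmodule_isLmodule.Build R (cfun R X)
  cfun_scaleA cfun_scale1 cfun_scaleDr cfun_scaleDl.

End CfunAlgebra.

Definition multiplication (R : realType) (X : topologicalType)
    (T : cfun R X -> cfun R X) : Prop :=
  exists a : cfun R X, forall f, T f = a * f.

Definition local_multiplication (R : realType) (X : topologicalType)
    (T : cfun R X -> cfun R X) : Prop :=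
  forall f, exists a : cfun R X, T f = a * f.

Definition cozero_set (R : realType) (S : topologicalType) (A : set S) : Prop :=
  exists f : cfun R S, A = [set s | f s != 0].

(* [A] coerces to [set_type A], which carries the subspace topology. *)
Definition F_space (R : realType) (S : topologicalType) : Prop :=
  [/\ hausdorff_space S, completely_regular_space S &
    forall A : set S, cozero_set R A ->
    forall g : continuousType A R, bounded_fun (g : A -> R) ->
    exists h : continuousType S R,
      bounded_fun (h : S -> R) /\ (forall s : A, h (set_val s) = g s)].

(* Main.v *)
Require Import Defs.
From HB Require Import structures.
From mathcomp Require Import all_boot all_order all_algebra.
From mathcomp Require Import complex.
From mathcomp Require Import all_classical all_reals all_analysis.
From mathcomp Require Import borel_hierarchy.
From mathcomp Require Import ring lra.
Set Implicit Arguments.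
Unset Strict Implicit.
Unset Printing Implicit Defensive.
Import Order.TTheory GRing.Theory Num.Theory.
Import numFieldNormedType.Exports.
Import mathcomp.real_closed.complex.
Local Open Scope classical_set_scope.
Local Open Scope complex_scope.
Local Open Scope ring_scope.

(** An R-linear local multiplication [T] can only be [f |-> alpha f + beta f^*].
Indeed [T f] vanishes wherever [f] does, so [T f x] depends on [f x] alone,
hence R-linearly, and an R-linear map of the complex plane is a combination of
the identity and conjugation ([linear_local_multiplicationE]). Such a [T] is a
multiplication exactly when [beta = 0], so the question is for which nonzero
[beta] the map [f |-> beta f^*] is a local multiplication.

If it is one, the unimodular function [f^* / f], defined where [f] does not
vanish, extends continuously over the open F-sigma set [U = {beta <> 0}]:
divide the local multiplier of [f] by [beta]. If [U] is an F-space, the extension exists because the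
real and imaginary parts of [f^* / f] are bounded and continuous on a
cozero-set; after multiplication by a function supported in [U] it even
extends by zero to the whole space ([F_space_conj_local]). So an open F-space
that is not empty produces a local multiplication [f |-> u f^*] with [u <> 0].

Conversely, every bounded real [g] on a cozero-set [A] of [U] is encoded in a
quotient [f^* / f]: with [f = r (1 + i g)], where [r] is positive on [A] and
decays fast enough for [f] to extend by zero to the whole space, the quotient
is the Cayley transform [(1 - i g) / (1 + i g)]. Since [g] is bounded this
transform stays away from its singular value -1, so that [g] can be computed
back continuously from the extension of the quotient over [U]
([cayley_recover]), and this extends [g] ([conj_local_F_space]). *)

(** * Continuity of complex-valued functions through real and imaginary parts *)

Lemma normr_Re_le (R : rcfType) (z : R[i]) : `|Re z|%:C <= `|z|.
Proof.
rewrite normc_def lecR -[leLHS]sqrtr_sqr ler_wsqrtr//.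
by rewrite lerDl sqr_ge0.
Qed.

Lemma normr_Im_le (R : rcfType) (z : R[i]) : `|Im z|%:C <= `|z|.
Proof.
rewrite normc_def lecR -[leLHS]sqrtr_sqr ler_wsqrtr//.
by rewrite lerDr sqr_ge0.
Qed.

Lemma normc_le_ReIm (R : rcfType) (z : R[i]) : `|z| <= (`|Re z| + `|Im z|)%:C.
Proof.
rewrite normc_def lecR -[leRHS]ger0_norm ?addr_ge0//.
rewrite -[leRHS]sqrtr_sqr ler_wsqrtr//.
by rewrite sqrrD !real_normK ?num_real// -addrA addrCA ler_wpDl//.
Qed.

Definition sqr_normc (R : rcfType) (z : R[i]) : R := Re z ^+ 2 + Im z ^+ 2.

Lemma sqr_normc_gt0 (R : rcfType) (z : R[i]) : (0 < sqr_normc z) = (z != 0).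
Proof.
rewrite lt_def addr_ge0 ?sqr_ge0// andbT; congr (~~ _).
by rewrite paddr_eq0 ?sqr_ge0// !sqrf_eq0 eq_complex.
Qed.

Section continuity.
Context {R : realType} {S : topologicalType}.
Implicit Types (f : S -> R[i]) (u v : S -> R).

Lemma continuous_Re f : continuous f -> continuous (fun x => Re (f x)).
Proof.
move=> cf x; apply/cvgrPdist_lt => e e0.
have e0' : 0 < e%:C by rewrite ltcR.
have /cvgrPdist_lt/(_ _ e0') := cf x.
apply: filterS => y; rewrite -ltcR; apply: le_lt_trans.
by rewrite -(raddfB (@Re R : Rcomplex R -> R)); exact: normr_Re_le.
Qed.

Lemma continuous_Im f : continuous f -> continuous (fun x => Im (f x)).
Proof.
move=> cf x; apply/cvgrPdist_lt => e e0.
have e0' : 0 < e%:C by rewrite ltcR.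
have /cvgrPdist_lt/(_ _ e0') := cf x.
apply: filterS => y; rewrite -ltcR; apply: le_lt_trans.
by rewrite -(raddfB (@Im R : Rcomplex R -> R)); exact: normr_Im_le.
Qed.

Lemma continuous_Complex u v :
  continuous u -> continuous v -> continuous (fun x => u x +i* v x).
Proof.
move=> cu cv x; apply/cvgrPdist_lt => e.
rewrite ltcE => /andP[/eqP/= e_im e0].
have e20 : 0 < Re e / 2 by rewrite divr_gt0.
have /cvgrPdist_lt/(_ _ e20) := cu x; have /cvgrPdist_lt/(_ _ e20) := cv x.
apply: filterS2 => y vy uy.
apply: le_lt_trans (normc_le_ReIm _) _.
by rewrite ltcE/= -e_im eqxx/= [ltRHS]splitr ltrD.
Qed.

Lemma continuous_addr u v :
  continuous u -> continuous v -> continuous (fun x => u x + v x).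
Proof. by move=> cu cv x; apply: cvgD; [exact: cu|exact: cv]. Qed.

Lemma continuous_oppr u : continuous u -> continuous (fun x => - u x).
Proof. by move=> cu x; apply: cvgN; exact: cu. Qed.

Lemma continuous_mulr u v :
  continuous u -> continuous v -> continuous (fun x => u x * v x).
Proof. by move=> cu cv x; apply: cvgM; [exact: cu|exact: cv]. Qed.

Lemma continuous_divr u v : (forall x, v x != 0) ->
  continuous u -> continuous v -> continuous (fun x => u x / v x).
Proof.
move=> v0 cu cv; apply: continuous_mulr => // x.
by apply: cvgV; [exact: v0|exact: cv].
Qed.

Lemma continuous_cst (r : R) : continuous (fun _ : S => r).
Proof. by move=> x; exact: cst_continuous. Qed.

Lemma continuous_maxr u v :
  continuous u -> continuous v -> continuous (fun x => Num.max (u x) (v x)).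
Proof. by move=> cu cv x; exact: (@continuous_max R S u v x (cu x) (cv x)). Qed.

Lemma continuous_minr u v :
  continuous u -> continuous v -> continuous (fun x => Num.min (u x) (v x)).
Proof. by move=> cu cv x; exact: (@continuous_min R S u v x (cu x) (cv x)). Qed.

Lemma continuous_sqr_normc f :
  continuous f -> continuous (fun x => sqr_normc (f x)).
Proof.
move=> cf; have cre := continuous_Re cf; have cim := continuous_Im cf.
by apply: continuous_addr; apply: continuous_mulr.
Qed.

Lemma open_neq0 (f : cfun R S) : open [set x | f x != 0].
Proof.
have -> : [set x | f x != 0] =
    (fun x => sqr_normc (f x)) @^-1` [set y | 0 < y].
  by apply/funext => x /=; rewrite sqr_normc_gt0.
apply: open_comp; last exact: open_gt.
by move=> x _; apply: continuous_sqr_normc; exact: cfun_cts.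
Qed.

Lemma Fsigma_neq0 (f : cfun R S) : Fsigma [set x | f x != 0].
Proof.
exists (fun n => (fun x => sqr_normc (f x)) @^-1` [set y | n.+1%:R^-1 <= y]).
  move=> n; apply: closed_comp; last exact: closed_ge.
  by move=> x _; apply: continuous_sqr_normc; exact: cfun_cts.
apply/seteqP; split => x /=.
  rewrite -sqr_normc_gt0 => fx.
  have [n] := ltr_add_invr fx; rewrite add0r => nfx.
  by exists n => //=; exact: ltW.
move=> [n _ /=]; rewrite -sqr_normc_gt0; apply: lt_le_trans.
by rewrite invr_gt0.
Qed.

(** * Products with bounded functions on an open set *)

(** The domain may be an empty subspace, which rules out [ex_bound]: that lemma
asks for a proper filter. *)
Lemma bounded_fun_realP (T : Type) (h : T -> R) :
  bounded_fun h <-> exists M, forall x, `|h x| <= M.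
Proof.
split=> [[M [Mreal]]|[M hM]].
  move=> /(_ (`|M| + 1)); rewrite (le_lt_trans (ler_norm _)) ?ltrDl//.
  by move=> /(_ erefl) hM; exists (`|M| + 1) => x; exact: hM.
exists M; split; first exact: num_real.
by move=> N MN x _ /=; apply: le_trans (hM x) (ltW MN).
Qed.

Lemma valL_set_val (A : set S) (h : A -> R) (a : A) :
  valL_ 0 h (set_val a) = h a.
Proof. by rewrite -[RHS](congr1 (fun k => k a) (valLK 0 h)). Qed.

(** Continuity is inherited from [h] at the points of the open set [A]; at the
other points [w] tends to 0 and [h], extended by 0, is bounded. *)
Lemma continuous_mul_zero_ext (A : set S) (w : S -> R) (h : A -> R) :
  open A -> continuous w -> (forall x, ~ A x -> w x = 0) ->
  continuous h -> bounded_fun h ->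
  continuous (fun x => w x * valL_ 0 h x).
Proof.
move=> oA cw w0 ch /bounded_fun_realP[M hM] x.
have [Ax|nAx] := pselect (A x).
  apply: continuousM; first exact: cw.
  move: x Ax; suff ctsA : {in A, continuous (valL_ 0 h)}.
    by move=> x /mem_set; exact: ctsA.
  by rewrite -continuous_open_subspace//; apply/subspace_valL_continuousP'.
rewrite /continuous_at w0// mul0r; apply: norm_cvg0.
have M0 y : `|valL_ 0 h y| <= `|M|.
  have [Ay|nAy] := pselect (A y).
    have -> : y = set_val (SigSub (mem_set Ay) : A) by [].
    by rewrite valL_set_val (le_trans (hM _))// ler_norm.
  rewrite /valL_ /= oinv_set_val; case: insubP => [u /set_mem//|_] /=.
  by rewrite normr0.
apply: (@squeeze_cvgr _ _ _ _ (cst 0) (fun y => `|w y| * `|M|)).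
- by apply: nearW => y; rewrite normr_ge0 normrM ler_wpM2l.
- exact: cvg_cst.
- rewrite -[X in _ --> X](mul0r `|M|); apply: cvgMl.
  by rewrite -[X in _ --> X](normr0 R) -(w0 x nAx); apply: cvg_norm; exact: cw.
Qed.

End continuity.

(** * Subspaces *)

Section subspace.
Context {S : topologicalType} (U : set S).

Lemma set_val_continuous : continuous (set_val : U -> S).
Proof. exact: initial_continuous. Qed.

Lemma continuous_comp_set_val (T : topologicalType) (k : S -> T) :
  continuous k -> continuous (fun s : U => k (set_val s)).
Proof.
move=> ck s; apply: (@continuous_comp _ _ _ set_val k); last exact: ck.
exact: set_val_continuous.
Qed.

Lemma hausdorff_subspace : hausdorff_space S -> hausdorff_space U.
Proof.
rewrite !open_hausdorff => h x y xy.
have /h[[A B] /= [/set_mem Ax /set_mem By] [oA oB /eqP AB]] :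
    set_val x != set_val y.
  by apply: contra_neq xy; exact: val_inj.
exists (set_val @^-1` A, set_val @^-1` B) => /=; first by rewrite !inE.
split; [by exists A|by exists B|].
by rewrite -preimage_setI AB preimage_set0.
Qed.

Lemma completely_regular_subspace (R : realType) :
  completely_regular_space S -> completely_regular_space U.
Proof.
move=> h x B clB nBx; apply/(@uniform_separatorP _ R).
have [V oV VB] := closed_openC clB.
have cVC : closed (~` V) by exact: open_closedC.
have nVx : ~ (~` V) (set_val x).
  apply; have : (~` B) x by [].
  by rewrite -VB.
have /(@uniform_separatorP _ R)[f [cf f01 f0 f1]] := h _ _ cVC nVx.
exists (f \o set_val); split.
- by move=> y; apply: continuous_comp; [exact: set_val_continuous|exact: cf].
- by move=> _ [y _ <-]; apply: f01; exists (set_val y).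
- by move=> _ [y -> <-]; apply: f0; exists (set_val x).
- move=> _ [y By <-]; apply: f1; exists (set_val y) => // Vy.
  by have : (~` B) y by rewrite -VB.
Qed.

End subspace.

(** * From F-spaces to local multiplications *)

Section local_conjugation.
Context {R : realType} {X : topologicalType}.

(** Local divisibility is obtained by extending the bounded function [f^* / f]
from the cozero-set [{f <> 0}] of [U] to [U]; multiplying by [u], which vanishes
off [U], brings it back to [X]. *)
Lemma F_space_conj_local (U : set X) (u : X -> R) :
  open U -> F_space R U -> continuous u -> (forall x, ~ U x -> u x = 0) ->
  forall f : cfun R X, exists a : cfun R X,
    forall x, (u x)%:C * (f x)^*%C = a x * f x.
Proof.
move=> oU [_ _ extU] cu u0 f.
pose A : set U := [set s | f (set_val s) != 0].
have cfU : continuous (fun s : U => f (set_val s)).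
  exact/continuous_comp_set_val/cfun_cts.
have cozA : cozero_set R A by exists (mk_cfun cfU).
pose p (s : A) := f (set_val (set_val s)).
have cp : continuous p by exact: (continuous_comp_set_val cfU).
have cpr := continuous_Re cp; have cpi := continuous_Im cp.
have p0 (s : A) : 0 < sqr_normc (p s).
  by rewrite sqr_normc_gt0; have /set_mem := valP s.
(* With q the conjugate of p, g1 and g2 are the real and imaginary parts of
   q / p = q^2 / |p|^2. *)
pose g1 s := (Re (p s) ^+ 2 - Im (p s) ^+ 2) / sqr_normc (p s).
pose g2 s := - (2 * (Re (p s) * Im (p s))) / sqr_normc (p s).
have cN := continuous_sqr_normc cp.
have pN0 s : sqr_normc (p s) != 0 by rewrite lt0r_neq0.
have cg1 : continuous g1.
  apply: continuous_divr => //; apply: continuous_addr.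
    exact: continuous_mulr.
  by apply: continuous_oppr; exact: continuous_mulr.
have cg2 : continuous g2.
  apply: continuous_divr => //; apply: continuous_oppr; apply: continuous_mulr.
    exact: continuous_cst.
  exact: continuous_mulr.
have bg1 : bounded_fun g1.
  apply/bounded_fun_realP; exists 1 => s.
  rewrite normrM normfV (gtr0_norm (p0 s)) ler_pdivrMr// mul1r.
  rewrite ler_norml /sqr_normc.
  by apply/andP; split; nra.
have bg2 : bounded_fun g2.
  apply/bounded_fun_realP; exists 1 => s.
  rewrite normrM normfV (gtr0_norm (p0 s)) ler_pdivrMr// mul1r.
  rewrite ler_norml /sqr_normc.
  have := sqr_ge0 (Re (p s) + Im (p s)).
  have := sqr_ge0 (Re (p s) - Im (p s)).
  by move=> ? ?; apply/andP; split; nra.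
have [h1 [bh1 h1E]] := extU A cozA (mkcts cg1) bg1.
have [h2 [bh2 h2E]] := extU A cozA (mkcts cg2) bg2.
have ca1 := continuous_mul_zero_ext oU cu u0 (@cts_fun _ _ h1) bh1.
have ca2 := continuous_mul_zero_ext oU cu u0 (@cts_fun _ _ h2) bh2.
exists (mk_cfun (continuous_Complex ca1 ca2)) => x.
rewrite -[RHS]/((u x * valL_ 0 h1 x +i* (u x * valL_ 0 h2 x)) * f x).
have [Ux|nUx] := pselect (U x); last by rewrite u0// !mul0r.
have [fx0|fx0] := eqVneq (f x) 0; first by rewrite fx0 conjc0 !mulr0.
pose s : U := SigSub (mem_set Ux).
have As : A s by [].
pose t : A := SigSub (mem_set As).
rewrite -[x]/(set_val s) !valL_set_val -[s]/(set_val t).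
rewrite (h1E t : _ = g1 t) (h2E t : _ = g2 t).
have := pN0 t; rewrite /g1 /g2 -[f _]/(p t) /sqr_normc.
case: (p t) => q1 q2 /= q0; simpc.
by congr (_ +i* _); field.
Qed.

(** * From local multiplications to F-spaces *)

(** The hypothesis reads [b - c = i t (b + c)], so [t] is the imaginary part of
[(b - c) / (b + c)], whose numerator over the real denominator [|b + c|^2] is
the one given. Moreover [|b + c|^2 = 4 |b|^2 / (1 + t^2)], so the bound on [t]
makes the maximum equal to [|b + c|^2]. The maximum is there because the
formula is going to be used at points where [b] and [c] are not related: its
denominator is positive as soon as [b <> 0]. *)
Lemma cayley_recover (b c : R[i]) (t M : R) : b != 0 -> `|t| <= M ->
  b * (1 -i* t) = c * (1 +i* t) ->
  t = 2 * (Im b * Re c - Re b * Im c) /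
      Num.max (sqr_normc (b + c)) (4 / (1 + M ^+ 2) * sqr_normc b).
Proof.
rewrite -sqr_normc_gt0 => b0 tM.
case: b c b0 => [b1 b2] [c1 c2]; rewrite /sqr_normc /=; simpc => b0 [e1 e2].
have M0 : 0 <= M by exact: le_trans tM.
have t2M : t ^+ 2 <= M ^+ 2.
  by rewrite -(real_normK (num_real t)) lerXn2r// nnegrE.
(* The real and imaginary parts of b - c = i t (b + c). *)
have d1 : b1 - c1 = - (t * (b2 + c2)) by lra.
have d2 : b2 - c2 = t * (b1 + c1) by lra.
have numE : 2 * (b2 * c1 - b1 * c2) = t * ((b1 + c1) ^+ 2 + (b2 + c2) ^+ 2).
  have -> : 2 * (b2 * c1 - b1 * c2) =
      (b2 - c2) * (b1 + c1) - (b1 - c1) * (b2 + c2) by ring.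
  by rewrite d1 d2; ring.
have sumE : ((b1 + c1) ^+ 2 + (b2 + c2) ^+ 2) * (1 + t ^+ 2) =
    4 * (b1 ^+ 2 + b2 ^+ 2).
  have -> : 4 * (b1 ^+ 2 + b2 ^+ 2) =
      ((b1 + c1) + (b1 - c1)) ^+ 2 + ((b2 + c2) + (b2 - c2)) ^+ 2 by ring.
  by rewrite d1 d2; ring.
have t1 : 0 < 1 + t ^+ 2 by rewrite ltr_pwDl// sqr_ge0.
have M1 : 0 < 1 + M ^+ 2 by rewrite ltr_pwDl// sqr_ge0.
have sum_gt0 : 0 < (b1 + c1) ^+ 2 + (b2 + c2) ^+ 2.
  by rewrite -(pmulr_lgt0 _ t1) sumE mulr_gt0.
rewrite max_l; first by rewrite numE mulfK// gt_eqF.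
by rewrite mulrAC ler_pdivrMr// -sumE ler_pM2l// lerD2l.
Qed.

(** To extend [g] from a cozero-set [A] of [U], local divisibility is applied to
[f = B w (1 + i g)] with [w > 0] on [A] and [B > 0] on [U]. The factor [w] makes
[f] extend by 0 from [A] to [U], and [B] from [U] to [X]. *)
Lemma conj_local_F_space (b : cfun R X) :
  hausdorff_space X -> completely_regular_space X ->
  (forall f : cfun R X, exists c : cfun R X,
    forall x, b x * (f x)^*%C = c x * f x) ->
  F_space R [set x | b x != 0].
Proof.
move=> hX crX locb; set U := [set x | b x != 0].
split; [exact: hausdorff_subspace|exact: (completely_regular_subspace R)|].
move=> A [v Av] g /bounded_fun_realP[M gM].
have oU : open U by exact: open_neq0.
have oA : open A by rewrite Av; exact: open_neq0.
pose w s := Num.min (sqr_normc (v s)) 1.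
have cw : continuous w.
  apply: continuous_minr; last exact: continuous_cst.
  exact/continuous_sqr_normc/cfun_cts.
have w_ge0 s : 0 <= w s by rewrite le_min ler01 addr_ge0 ?sqr_ge0.
have w_le1 s : w s <= 1 by rewrite ge_min lexx orbT.
have w_out s : ~ A s -> w s = 0.
  rewrite Av /= => /negP; rewrite negbK /w => /eqP ->.
  by rewrite /sqr_normc/= expr0n addr0 min_l.
have w_in s : A s -> 0 < w s by rewrite Av lt_min ltr01 sqr_normc_gt0 andbT.
(* k is w g, extended by 0 from A to U. *)
have bg : bounded_fun (g : A -> R) by apply/bounded_fun_realP; exists M.
have ck := continuous_mul_zero_ext oA cw w_out (@cts_fun _ _ g) bg.
set k := fun s => _ in ck.
have bw : bounded_fun w.
  by apply/bounded_fun_realP; exists 1 => s; rewrite ger0_norm.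
have bk : bounded_fun k.
  apply/bounded_fun_realP; exists `|M| => s.
  rewrite normrM (ger0_norm (w_ge0 s)).
  have [As|nAs] := pselect (A s); last by rewrite w_out// mul0r.
  rewrite -[X in valL_ _ _ X]/(set_val (SigSub (mem_set As) : A)) valL_set_val.
  by rewrite -[leRHS]mul1r ler_pM// (le_trans (gM _))// ler_norm.
pose B x := sqr_normc (b x).
have cB : continuous B by exact/continuous_sqr_normc/cfun_cts.
have B_out x : ~ U x -> B x = 0.
  move=> /negP; rewrite negbK => /eqP bx.
  by rewrite /B bx /sqr_normc/= expr0n addr0.
have cf1 := continuous_mul_zero_ext oU cB B_out cw bw.
have cf2 := continuous_mul_zero_ext oU cB B_out ck bk.
have [c cE] := locb (mk_cfun (continuous_Complex cf1 cf2)).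
pose num x := 2 * (Im (b x) * Re (c x) - Re (b x) * Im (c x)).
pose den x :=
  Num.max (sqr_normc (b x + c x)) (4 / (1 + M ^+ 2) * sqr_normc (b x)).
have cnum : continuous num.
  have cb1 := continuous_Re (@cfun_cts _ _ b).
  have cb2 := continuous_Im (@cfun_cts _ _ b).
  have cc1 := continuous_Re (@cfun_cts _ _ c).
  have cc2 := continuous_Im (@cfun_cts _ _ c).
  apply: continuous_mulr; first exact: continuous_cst.
  by apply: continuous_addr; [|apply: continuous_oppr]; apply: continuous_mulr.
have cden : continuous den.
  apply: continuous_maxr.
    exact: (continuous_sqr_normc (@cfun_cts _ _ (b + c))).
  by apply: continuous_mulr => //; exact: continuous_cst.
have den0 (s : U) : den (set_val s) != 0.
  rewrite gt_eqF// lt_max orbC mulr_gt0//.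
    by rewrite divr_gt0// ltr_pwDl// sqr_ge0.
  by rewrite sqr_normc_gt0; have /set_mem := valP s.
pose h0 (s : U) := num (set_val s) / den (set_val s).
have ch0 : continuous h0.
  by apply: continuous_divr => //; exact: continuous_comp_set_val.
(* Outside A nothing bounds h0, so it is truncated. *)
pose h s := Num.max (- `|M|) (Num.min `|M| (h0 s)).
have ch : continuous h.
  apply: continuous_maxr; first exact: continuous_cst.
  by apply: continuous_minr => //; exact: continuous_cst.
exists (mkcts ch); split.
  apply/bounded_fun_realP; exists `|M| => s.
  rewrite -[X in `|X|]/(h s) ler_norml /h le_max lexx/=.
  rewrite ge_max ge_min lexx/= andbT.
  by rewrite (le_trans _ (normr_ge0 M))// oppr_le0.
move=> s; rewrite -[LHS]/(h (set_val s)).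
suff h0E : h0 (set_val s) = g s.
  have := gM s; rewrite ler_norml => /andP[Mg gM'].
  have M0 : 0 <= M by exact: le_trans (gM s).
  by rewrite /h h0E (ger0_norm M0) min_r// max_r.
have As : A (set_val s) by exact/set_mem/(valP s).
set y := set_val (set_val s).
have Uy : U y by exact/set_mem/(valP (set_val s)).
symmetry; apply: cayley_recover => //.
have := cE y.
rewrite -[mk_cfun _ _]/(B y * valL_ 0 w y +i* (B y * valL_ 0 k y)).
rewrite !valL_set_val /k valL_set_val.
set r := B _; set r' := w _.
have rr0 : (r * r')%:C != 0.
  rewrite eq_complex/= eqxx andbT gt_eqF// mulr_gt0 ?w_in//.
  by rewrite /r /B sqr_normc_gt0.
have -> : r * r' +i* (r * (r' * g s)) = (r * r')%:C * (1 +i* g s).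
  by simpc; rewrite mulrA.
rewrite (rmorphM (@conjc R)) /= oppr0 => e.
apply: (mulfI rr0); rewrite mulrCA e; ring.
Qed.

(** * The form of real-linear local multiplications *)

(** The difference of [f] and the constant function [f x] vanishes at [x], hence
so does its image under [T]; the image of the constant is found by linearity. *)
Lemma linear_local_multiplicationE (T : {linear cfun R X -> cfun R X}) :
  local_multiplication T -> forall f x,
  T f x = T (cfun_cst 1) x * (Re (f x))%:C +
          T (cfun_cst 'i%C) x * (Im (f x))%:C.
Proof.
move=> locT f x.
pose h : cfun R X := Re (f x) *: (cfun_cst 1 : cfun R X) +
                     Im (f x) *: (cfun_cst 'i%C : cfun R X).
have h0 : (f - h) x = 0.
  rewrite -[LHS]/(f x - ((Re (f x))%:C * 1 + (Im (f x))%:C * 'i%C)).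
  by rewrite mulr1 {1}[f x]complexE mulrC subrr.
have : T (f - h) x = 0.
  have [a ->] := locT (f - h).
  by rewrite -[LHS]/(a x * (f - h) x) h0 mulr0.
rewrite linearB linearD !linearZ.
rewrite -[LHS]/(T f x - ((Re (f x))%:C * T (cfun_cst 1) x +
                         (Im (f x))%:C * T (cfun_cst 'i%C) x)).
by move/eqP; rewrite subr_eq0 => /eqP ->; rewrite ![_%:C * _]mulrC.
Qed.

End local_conjugation.

Section mul_conj.
Context {R : realType} {X : topologicalType} (u : cfun R X).

Fact mul_conj_subproof (f : cfun R X) : continuous (fun x => u x * (f x)^*%C).
Proof.
have cf := @cfun_cts _ _ f.
have ccf : continuous (fun x => (f x)^*%C).
  have -> : (fun x => (f x)^*%C) = (fun x => Re (f x) +i* - Im (f x)).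
    by apply/funext => x; case: (f x).
  apply: continuous_Complex; first exact: continuous_Re.
  exact/continuous_oppr/continuous_Im.
by move=> x; apply: continuousM; [exact: cfun_cts|exact: ccf].
Qed.

Definition mul_conj (f : cfun R X) : cfun R X := mk_cfun (@mul_conj_subproof f).

Fact mul_conj_linear : linear mul_conj.
Proof.
move=> k f g; apply: cfunP => x.
rewrite -[LHS]/(u x * (k%:C * f x + g x)^*%C).
rewrite -[RHS]/(k%:C * (u x * (f x)^*%C) + u x * (g x)^*%C).
have -> : (k%:C * f x + g x)^*%C = k%:C * (f x)^*%C + (g x)^*%C.
  by rewrite (rmorphD (@conjc R)) (rmorphM (@conjc R)) /= oppr0.
ring.
Qed.

HB.instance Definition _ :=
  GRing.isLinear.Build R (cfun R X) (cfun R X) _ mul_conj mul_conj_linear.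

End mul_conj.

(** * The characterization *)

Theorem corollary5 (R : realType) (X : topologicalType)
    (cptX : compact [set: X]) (hausX : hausdorff_space X) :
  (forall U : set X, U !=set0 -> open U -> Fsigma U -> ~ F_space R U) <->
  (forall T : {linear cfun R X -> cfun R X},
    local_multiplication T -> multiplication T).
Proof.
have crX : completely_regular_space X.
  apply: (@normal_completely_regular R); last exact: hausdorff_accessible.
  exact: compact_normal.
split.
- move=> noF T locT.
  have TE := linear_local_multiplicationE locT.
  set a := T (cfun_cst 1) in TE; set b := T (cfun_cst 'i%C) in TE.
  (* If T f = A f + B f^*, then T 1 + i T i = 2 B and T 1 - i T i = 2 A. *)
  pose beta : cfun R X := a + cfun_cst 'i%C * b.
  have [beta0|] := pselect (beta = 0).
    exists a => f; apply: cfunP => x.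
    rewrite -[RHS]/(a x * f x); apply: etrans (TE f x) _.
    have bE : b x = 'i%C * a x.
      have : beta x = 0 by rewrite beta0.
      rewrite -[LHS]/(a x + 'i%C * b x) => /(congr1 (fun z => 'i%C * z)).
      rewrite mulr0 mulrDr mulrA -expr2 sqr_i mulN1r => /eqP.
      by rewrite subr_eq0 => /eqP.
    rewrite bE [in RHS](complexE (f x)); ring.
  move=> betaN0; exfalso.
  apply: (noF [set x | beta x != 0]).
  + apply: contrapT => beta0; apply: betaN0; apply: cfunP => x.
    by apply: contrapT => /eqP betax; apply: beta0; exists x.
  + exact: open_neq0.
  + exact: Fsigma_neq0.
  + apply: conj_local_F_space => // f.
    have [c cE] := locT f.
    (* 2 B f^* = 2 T f - 2 A f, and T f = c f. *)
    exists (c + c - a + cfun_cst 'i%C * b) => x.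
    rewrite -[beta x]/(a x + 'i%C * b x).
    rewrite -[RHS]/((c x + c x - a x + 'i%C * b x) * f x).
    have : c x * f x = a x * (Re (f x))%:C + b x * (Im (f x))%:C.
      by rewrite -[LHS]/((c * f) x) -cE; exact: TE.
    rewrite !mulrDl => ->.
    have -> : (f x)^*%C = (Re (f x))%:C - 'i%C * (Im (f x))%:C.
      by case: (f x) => p q; simpc.
    have := complexE (f x); move: (Re (f x)) (Im (f x)) => p q ->.
    have : 'i%C * 'i%C = -1 :> R[i] by rewrite -expr2 sqr_i.
    by move: 'i%C => i i2; ring: i2.
- move=> multT U [x Ux] oU _ FU.
  have cUC : closed (~` U) by exact: open_closedC.
  have nUCx : ~ (~` U) x by apply.
  have /(@uniform_separatorP _ R)[v [cv _ v0 v1]] := crX _ _ cUC nUCx.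
  pose w y := 1 - v y.
  have cw : continuous w.
    by apply: continuous_addr; [exact: continuous_cst|exact: continuous_oppr].
  have w0 y : ~ U y -> w y = 0.
    by move=> nUy; rewrite /w (v1 (v y)) ?subrr//; exists y.
  have w1 : w x = 1 by rewrite /w (v0 (v x)) ?subr0//; exists x.
  pose u := mk_cfun (continuous_Complex cw (@continuous_cst R X 0)).
  have /multT[a aE] : local_multiplication (mul_conj u).
    move=> f; have [a aE] := F_space_conj_local oU FU cw w0 f.
    by exists a; apply: cfunP => y; exact: aE.
  (* Multiplication by a sends 1 to u and i to - i u, so u vanishes,
     although u x = 1. *)
  have := congr1 (fun f : cfun R X => f x) (aE (cfun_cst 1)).
  rewrite -[LHS]/((w x)%:C * 1^*%C) -[RHS]/(a x * 1) conjc1 w1 !mulr1 => a1.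
  have := congr1 (fun f : cfun R X => f x) (aE (cfun_cst 'i%C)).
  rewrite -[LHS]/((w x)%:C * 'i^*%C) -[RHS]/(a x * 'i) -a1 w1 !mul1r => /eqP.
  rewrite eq_complex/= eqxx/= => /eqP; lra.
Qed.
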